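(* Let $\Phi$ be a semiflow relation on a compact metric space $X$, and assume that the closed set $C\subset X$ is an isolating neighborhood for a viable set $A$ (that is, $A=C_\pm\subset C^\circ$). (a) If $(P_1,P_2)$ is a $\Phi$ index pair rel $C$ for $A$, then $C_- \subset P_1$ and $C_+ \cap P_2 = \emptyset$. In addition, $\delta_{\Phi}(P_1) \subset P_1 \cap \partial C \subset P_2$. In addition, if $\overline{P_1\setminus P_2}\subset C^\circ$, then for some $\epsilon > 0$, $\delta_{\phi^{[0,\epsilon]}}(P_1) \subset P_2$. (b) If $U$ and $V$ are open subsets of $X$ with $C_- \subset U$ and $C_{\pm} \subset V \subset C$, then there exist a simple isolating neighborhood $C_0$ and a $\Phi$ index pair $(P_1,P_2)$ rel $C$ for $A$ with $P_1 \subset U$ and such that $\overline{P_1 \setminus P_2} \subset C_0 \subset V$. In particular, $\overline{P_1\setminus P_2}\subset C^\circ$.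
   Context: A semiflow relation on $X$ is a closed subset $\Phi\subset X\times[0,\infty)\times X$ such that, with $\phi^t=\{(x,y):(x,t,y)\in\Phi\}$: $\phi^0$ is the diagonal, and $\phi^{t_1}\circ\phi^{t_2}=\phi^{t_1+t_2}$ (composition of relations) for all $t_1,t_2\ge0$. For compact $K\subset[0,\infty)$, $\phi^K=\bigcup_{t\in K}\phi^t$. A solution path is a function $\mathbf{x}$ from a closed (bounded or unbounded) interval of $\mathbb{R}$ to $X$ with $(\mathbf{x}(t_1),t_2-t_1,\mathbf{x}(t_2))\in\Phi$ whenever $t_1<t_2$ in the interval. The reverse is $\overline\Phi=\{(y,t,x):(x,t,y)\in\Phi\}$. For closed $C$: $\Phi_C$ is the set of $(x,t,y)\in C\times[0,\infty)\times C$ such that there is a solution path $\mathbf{x}:[0,t]\to C$ with $\mathbf{x}(0)=x$, $\mathbf{x}(t)=y$; it is a semiflow relation on $C$. A set $P\subset C$ is $\Phi_C$ + invariant if $x\in P$, $(x,t,y)\in\Phi_C$ imply $y\in P$. $C_+$ (resp. $C_-$) is the set of $x\in C$ such that there is a solution path $[0,\infty)\to C$ (resp. $(-\infty,0]\to C$) with value $x$ at $0$; $C_\pm=C_+\cap C_-$, the maximum viable subset of $C$, where a set is viable if through each of its points passes a solution path $\mathbb{R}\to X$ contained in the set. $\partial C=C\setminus C^\circ$. $C$ is an isolating neighborhood (for $C_\pm$) if $C_\pm\subset C^\circ$. A point $x\in C$ is terminal for $\Phi_C$ if $(x,t,y)\in\Phi_C$ implies $t=0$; $C$ is a simple isolating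 neighborhood if every $x\in\partial C$ is terminal for $\Phi_C$ or for $\overline{\Phi}_C$ (the restriction to $C$ of the reverse). For a relation $F$ and closed $P$: $\rho_F(P)=\overline{F(P)\setminus P}$ and $\delta_F(P)=P\cap\rho_F(P)$. $\delta_\Phi(P)=\bigcap_{\epsilon>0}\rho_{\phi^{[0,\epsilon]}}(P)$. A $\Phi$ index pair rel $C$ for $A$ ($C$ an isolating neighborhood for $A=C_\pm$) is a pair $(P_1,P_2)$ of closed subsets of $X$ with: (i) $P_2\subset P_1\subset C$; (ii) $P_1$ and $P_2$ are $\Phi_C$ + invariant; (iii) $A=C_\pm\subset P_1^\circ\setminus P_2$; (iv) $P_1\setminus P_2\subset C^\circ$. *)

(* Defs.v *)
From mathcomp Require Import all_boot all_order all_algebra.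
From mathcomp Require Import boolp classical_sets functions set_interval reals.
From mathcomp Require Import topology normedtype.

Set Implicit Arguments.
Unset Strict Implicit.
Unset Printing Implicit Defensive.

Import Order.TTheory GRing.Theory Num.Theory.
Import numFieldTopology.Exports.

Local Open Scope classical_set_scope.
Local Open Scope ring_scope.

Section SemiflowRelations.
Context {R : realType} {X : metricType R}.
Implicit Types (Phi : set (X * R * X)) (F : set (X * X)) (C A P : set X).

Definition time_map Phi (t : R) : set (X * X) :=
  [set xy | Phi (xy.1, t, xy.2)].

Definition time_set_map Phi (K : set R) : set (X * X) :=
  \bigcup_(t in K) time_map Phi t.

(* Times live in all of R; the first field confines them to [0, +oo[. Since
   [0, +oo[ is closed in R, closedness in X * R * X is the same as closedness
   in X * [0, +oo[ * X. *)
Record semiflow_relation Phi : Prop := {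
  semiflow_time_ge0 : forall x t y, Phi (x, t, y) -> 0 <= t;
  semiflow_closed : closed Phi;
  semiflow_diagonal : time_map Phi 0 = diagonal;
  semiflow_comp : forall t1 t2, 0 <= t1 -> 0 <= t2 ->
    (time_map Phi t1 \; time_map Phi t2)%relation = time_map Phi (t1 + t2) }.

(* Only the values of u on I matter. It is applied only to closed
   intervals I. *)
Definition solution_path Phi (I : set R) (u : R -> X) : Prop :=
  forall t1 t2, I t1 -> I t2 -> t1 < t2 -> Phi (u t1, t2 - t1, u t2).

Definition solution_path_in Phi (I : set R) C (u : R -> X) : Prop :=
  solution_path Phi I u /\ u @` I `<=` C.

Definition reverse Phi : set (X * R * X) :=
  [set p | let: (y, t, x) := p in Phi (x, t, y)].

Definition restriction Phi C : set (X * R * X) :=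
  [set p | let: (x, t, y) := p in
    0 <= t /\ exists u, [/\ solution_path_in Phi `[0, t] C u, u 0 = x & u t = y]].

Definition plus_invariant Phi P : Prop :=
  forall x t y, P x -> Phi (x, t, y) -> P y.

Definition plus_viable_part Phi C : set X :=
  [set x | exists u, solution_path_in Phi `[0, +oo[ C u /\ u 0 = x].

Definition minus_viable_part Phi C : set X :=
  [set x | exists u, solution_path_in Phi `]-oo, 0] C u /\ u 0 = x].

Definition viable_part Phi C : set X :=
  plus_viable_part Phi C `&` minus_viable_part Phi C.

Definition viable Phi A : Prop :=
  forall x, A x -> exists u, solution_path_in Phi setT A u /\ exists t, u t = x.

Definition boundary C : set X := C `\` C°.

Record isolating_neighborhood Phi C A : Prop := {
  isolating_closed : closed C;
  isolating_viable_part : A = viable_part Phi C;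
  isolating_interior : A `<=` C° }.

Definition terminal Phi (x : X) : Prop :=
  forall t y, Phi (x, t, y) -> t = 0.

Definition simple_isolating_neighborhood Phi C : Prop :=
  isolating_neighborhood Phi C (viable_part Phi C) /\
  forall x, boundary C x ->
    terminal (restriction Phi C) x \/ terminal (restriction (reverse Phi) C) x.

Definition relation_image F P : set X := [set y | exists2 x, P x & F (x, y)].

Definition rho F P : set X := closure (relation_image F P `\` P).

Definition delta F P : set X := P `&` rho F P.

(* Unlike delta, this is not intersected with P. *)
Definition semiflow_delta Phi P : set X :=
  \bigcap_(e in [set e : R | 0 < e]) rho (time_set_map Phi `[0, e]) P.

Record index_pair Phi C A (P1 P2 : set X) : Prop := {
  index_pair_isolating : isolating_neighborhood Phi C A;
  index_pair_closed1 : closed P1;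
  index_pair_closed2 : closed P2;
  index_pair_sub : P2 `<=` P1 /\ P1 `<=` C;
  index_pair_invariant1 : plus_invariant (restriction Phi C) P1;
  index_pair_invariant2 : plus_invariant (restriction Phi C) P2;
  index_pair_viable : A `<=` P1° `\` P2;
  index_pair_interior : P1 `\` P2 `<=` C° }.

End SemiflowRelations.

(* Main.v *)
Require Import Defs.
From mathcomp Require Import all_boot all_order all_algebra.
From mathcomp Require Import boolp classical_sets functions set_interval reals.
From mathcomp Require Import topology normedtype sequences.
From mathcomp Require Import lra.

Set Implicit Arguments.
Unset Strict Implicit.
Unset Printing Implicit Defensive.

Import Order.TTheory GRing.Theory Num.Theory.
Import numFieldTopology.Exports numFieldNormedType.Exports.

Local Open Scope classical_set_scope.
Local Open Scope ring_scope.

(** Since [Phi] is closed and [X] is compact, pointwise limits of solution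
    paths along an ultrafilter exist and are again solution paths
    ([limit_path]), even though a path need not be continuous a priori. Taking
    such limits shows that any two points related by [Phi] are joined by a path
    ([semiflow_path]), that [Phi_C] is closed ([restriction_limit]), and that
    the endpoints of longer and longer paths in [C] accumulate only on [C_-]
    ([restriction_limit_infty]).

    Part (a). Following a path in [C] back to time [-oo], one accumulates on the
    viable part [A] ([backward_limit]). As [A] is interior to [P1], such a path
    comes from [P1], hence stays there, so [C_-] lies in [P1]; applied to the
    reverse semiflow, the same fact excludes a point of [C_+] in [P2], whose
    forward orbit would accumulate on [A] inside the closed set [P2]. A point of
    [semiflow_delta Phi P1] is a limit of points that leave [P1] in arbitrarily
    short time. Near an interior point of [C] short paths stay in [C]
    ([short_path_inside]), where [P1] is invariant; so the point is on the
    boundary of [C]. The uniform [e] of the last claim follows by compactness.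

    Part (b). The heart is [strict_neighborhood]: [C_-] has arbitrarily small
    closed neighborhoods [P] such that [Phi_C] moves [P] into the interior of
    [P] at every positive time. Let [Q] be such a neighborhood of [C_+] for the
    reverse semiflow, and choose both so small that [P] and [Q] meet only
    inside [V]. Then [C0 = C] cut by [P] and [Q] is simple: a boundary point of
    [C0] is on the boundary of [P], and cannot be reached inside [C0], or on the
    boundary of [Q], and cannot be left inside [C0]. The index pair consists of
    [P] cut by [C] and of the part of it outside the interior of [Q].

    To build [P] one works with the closed relations [late C t], which relate
    [x] to [y] when [Phi_C] leads from [x] to [y] in a time at least [t], or
    when [y] is in [C_-]. In general an invariant neighborhood is not moved
    into its own interior at small times. The remedy is to sandwich [P] between
    increasing sets [A_n] and decreasing sets [B_n], where each
    [A_n] is interior to [A_(n+1)] and [late C (t / 2 ^ n)] takes [B_n] into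
    [A_n] ([inward_pair_refine]). The intersection [P] of the [B_n] is then
    moved into some [A_n], hence into its interior, at every positive time
    ([inward_neighborhood]). *)

(** * Limits along ultrafilters *)

(** Each index set where [f] is in a given neighborhood of a cluster point is
    either in [G] or has its complement in [G], and the latter contradicts
    clustering. *)
Lemma ultra_limit {I : Type} {G : set_system I} {UG : UltraFilter G}
    {T : topologicalType} (K : set T) (f : I -> T) :
  compact K -> (\forall i \near G, K (f i)) -> exists2 p, K p & f @ G --> p.
Proof.
move=> cK fK; have [p [Kp clp]] := cK (f @ G) _ fK.
exists p => // B Bp; have [//|GnB] := in_ultra_setVsetC (f @^-1` B) UG.
by have [q [nBq /nBq]] := clp (~` B) B GnB Bp.
Qed.

Lemma closure_ultra {T : topologicalType} (E : set T) p : closure E p ->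
  exists G : set_system T, [/\ UltraFilter G, G E & G --> p].
Proof.
move=> Ep; have PF : ProperFilter (within E (nbhs p)) := within_nbhs_proper Ep.
have [G [UG sG]] := ultraFilterLemma PF.
exists G; split => //; first by apply: sG; exact: withinT.
exact: (cvg_trans sG (@cvg_within _ _ _ _)).
Qed.

Lemma closed_ultra {T : topologicalType} (E : set T) :
  (forall (G : set_system T) p, UltraFilter G -> G E -> G --> p -> E p) ->
  closed E.
Proof. by move=> H p /closure_ultra[G [UG GE Gp]]; exact: (H G). Qed.

Lemma sequence_ultra : exists G : set_system nat, UltraFilter G /\ \oo `<=` G.
Proof. by apply: ultraFilterLemma; exact: eventually_filter. Qed.

(** * Solution paths and the restricted semiflow *)

Section SolutionPaths.
Context {R : realType} {X : metricType R} (Phi : set (X * R * X)).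
Hypothesis semiflow_Phi : semiflow_relation Phi.

Lemma semiflow_refl x : Phi (x, 0, x).
Proof.
have : @diagonal X (x, x) by [].
by rewrite -(semiflow_diagonal semiflow_Phi).
Qed.

Lemma semiflow_refl_eq x y : Phi (x, 0, y) -> x = y.
Proof.
move=> h; have : time_map Phi 0 (x, y) by [].
by rewrite (semiflow_diagonal semiflow_Phi).
Qed.

Lemma semiflow_trans {x s y t z} :
  Phi (x, s, y) -> Phi (y, t, z) -> Phi (x, s + t, z).
Proof.
move=> xy yz; have s0 := semiflow_time_ge0 semiflow_Phi xy.
have t0 := semiflow_time_ge0 semiflow_Phi yz.
have : time_map Phi (t + s) (x, z).
  by rewrite -(semiflow_comp semiflow_Phi)//; exists y.
by rewrite addrC.
Qed.

Lemma semiflow_split {x s t z} : 0 <= s -> 0 <= t -> Phi (x, s + t, z) ->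
  exists2 y, Phi (x, s, y) & Phi (y, t, z).
Proof.
move=> s0 t0 xz; have : time_map Phi (t + s) (x, z) by rewrite addrC.
by rewrite -(semiflow_comp semiflow_Phi)// => -[y ? ?]; exists y.
Qed.

Lemma solution_path_le {I : set R} {u : R -> X} {a b} : solution_path Phi I u ->
  I a -> I b -> a <= b -> Phi (u a, b - a, u b).
Proof.
move=> pu Ia Ib; rewrite le_eqVlt => /predU1P[<-|]; last exact: pu.
by rewrite subrr; exact: semiflow_refl.
Qed.

Lemma semiflow_limit {I : Type} {G : set_system I} {PG : ProperFilter G}
    (x_ : I -> X) (t_ : I -> R) (y_ : I -> X) x t y :
  x_ @ G --> x -> t_ @ G --> t -> y_ @ G --> y ->
  (\forall i \near G, Phi (x_ i, t_ i, y_ i)) -> Phi (x, t, y).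
Proof.
move=> xx tt yy H.
apply: (@closed_cvg _ _ G _ (fun i => (x_ i, t_ i, y_ i)) Phi
  (semiflow_closed semiflow_Phi) H).
exact: (cvg_pair (cvg_pair xx tt) yy).
Qed.

Lemma solution_path_shift {I J : set R} {C : set X} {u : R -> X} (a : R) :
  solution_path_in Phi I C u -> (forall s, J s -> I (s + a)) ->
  solution_path_in Phi J C (fun s => u (s + a)).
Proof.
move=> [pu uC] JI; split.
  move=> s t Js Jt st.
  have -> : t - s = (t + a) - (s + a) by lra.
  by apply: pu; [exact: JI|exact: JI|lra].
by move=> _ [s Js <-]; apply: uC; exists (s + a) => //; exact: JI.
Qed.

Lemma solution_path_sub {I J : set R} {C D : set X} {u : R -> X} :
  J `<=` I -> C `<=` D ->
  solution_path_in Phi I C u -> solution_path_in Phi J D u.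
Proof.
move=> JI CD [pu uC]; split; first by move=> s t /JI Is /JI It; exact: pu.
by move=> _ [s /JI Is <-]; apply/CD/uC; exists s.
Qed.

(** Only pairs of times on both sides of [a] need an argument: [Phi] relates
    the two values through the common value at time [a]. *)
Lemma solution_path_cat {I : set R} {C : set X} {u v : R -> X} (a : R) :
  I a -> u a = v a ->
  solution_path_in Phi (I `&` `]-oo, a]) C u ->
  solution_path_in Phi (I `&` `[a, +oo[) C v ->
  solution_path_in Phi I C (fun s => if s <= a then u s else v s).
Proof.
move=> Ia uva [pu uC] [pv vC]; split; last first.
  move=> _ [s Is <-]; have [sa|sa] := leP s a.
    by apply: uC; exists s => //; split => //=; rewrite in_itv.
  by apply: vC; exists s => //; split => //=; rewrite in_itv/= (ltW sa).
move=> s t Is It st; have [ta|ta] := leP t a.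
  have sa : s <= a by lra.
  by rewrite sa; apply: pu => //; split => //=; rewrite in_itv.
have [sa|sa] := leP s a; last first.
  by apply: pv => //; split => //=; rewrite in_itv/= andbT ltW.
have -> : t - s = (a - s) + (t - a) by lra.
apply: (@semiflow_trans _ _ (u a)).
  by apply: (solution_path_le pu) => //; split => //=; rewrite in_itv/=.
rewrite uva; apply: pv => //; split => //=; rewrite in_itv/= andbT //.
exact: ltW.
Qed.

Lemma restriction_path {I : set R} {C : set X} {u : R -> X} a b :
  solution_path_in Phi I C u -> a <= b -> (forall s, a <= s <= b -> I s) ->
  restriction Phi C (u a, b - a, u b).
Proof.
move=> pu ab abI; split; first lra.
exists (fun s => u (s + a)); split; rewrite ?add0r ?subrK//.
apply: (solution_path_shift (a := a) pu) => s /=; rewrite in_itv/= => sab.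
by apply: abI; lra.
Qed.

Lemma restriction_phi {C : set X} {x t y} :
  restriction Phi C (x, t, y) -> [/\ C x, Phi (x, t, y) & C y].
Proof.
move=> [t0 [u [[pu uC] <- <-]]].
have [I0 It] : `[0, t]%classic 0 /\ `[0, t]%classic t.
  by rewrite /= !in_itv/= !lexx t0.
split; first by apply: uC; exists 0.
  by rewrite -{1}(subr0 t); exact: (solution_path_le pu).
by apply: uC; exists t.
Qed.

Lemma restriction_trans {C : set X} {x s y t z} :
  restriction Phi C (x, s, y) -> restriction Phi C (y, t, z) ->
  restriction Phi C (x, s + t, z).
Proof.
move=> [s0 [u [pu u0 us]]] [t0 [v [pv v0 vt]]].
split; first exact: addr_ge0.
exists (fun r => if r <= s then u r else v (r - s)); split.
- apply: (@solution_path_cat `[0, s + t] C u (fun r => v (r - s)) s).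
  + by rewrite /= in_itv/= s0 lerDl.
  + by rewrite subrr us v0.
  + apply: solution_path_sub pu => // r /= [].
    by rewrite !in_itv/= => /andP[-> _] ->.
  + apply: (solution_path_shift (a := (- s)) pv) => r /= [].
    by rewrite !in_itv/=; lra.
- by rewrite s0.
- have [st|st] := leP (s + t) s; last by rewrite addrC addKr.
  have t00 : t = 0 by lra.
  by rewrite t00 addr0 us -v0 -vt t00.
Qed.

(** A path coming from time [-oo] is prolonged by the path given by [Phi_C],
    and time is shifted so that the end is at time 0. *)
Lemma minus_viable_invariant (C : set X) :
  plus_invariant (restriction Phi C) (minus_viable_part Phi C).
Proof.
move=> x t y [u [pu u0]] [t0 [v [pv v0 vt]]].
exists (fun r => if r <= - t then u (r + t) else v (r + t)); split.
- apply: (@solution_path_cat `]-oo, 0] C (fun r => u (r + t))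
    (fun r => v (r + t)) (- t)).
  + by rewrite /= in_itv/=; lra.
  + by rewrite addNr u0 v0.
  + apply: (solution_path_shift (a := t) pu) => r /= [].
    by rewrite !in_itv/=; lra.
  + apply: (solution_path_shift (a := t) pv) => r /= [].
    by rewrite !in_itv/=; lra.
- have [st|st] := leP 0 (- t); last by rewrite add0r.
  have t00 : t = 0 by lra.
  by rewrite t00 addr0 u0 -v0 -vt t00.
Qed.

Lemma viable_part_mono (C D : set X) : C `<=` D ->
  viable_part Phi C `<=` viable_part Phi D.
Proof.
move=> CD x [[u [pu u0]] [v [pv v0]]].
split; [exists u|exists v]; split => //.
  by apply: solution_path_sub pu.
by apply: solution_path_sub pv.
Qed.

End SolutionPaths.

(** * Limits of solution paths *)

Section CompactPaths.
Context {R : realType} {X : metricType R} (Phi : set (X * R * X)).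
Hypotheses (compactX : compact [set: X]) (semiflow_Phi : semiflow_relation Phi).

(** The condition defining a solution path involves two times only, so it is
    closed for pointwise convergence. The prescribed durations [d i s t] need
    only converge to [t - s]; this slack allows discretized paths and paths
    with varying domains. *)
Lemma limit_path {I : Type} {G : set_system I} {UG : UltraFilter G}
    {J : set R} {C : set X} (u : I -> R -> X) (d : I -> R -> R -> R) :
  closed C ->
  (forall s, J s -> \forall i \near G, C (u i s)) ->
  (forall s t, J s -> J t -> s < t ->
     \forall i \near G, Phi (u i s, d i s t, u i t)) ->
  (forall s t, J s -> J t -> s < t -> d i s t @[i --> G] --> t - s) ->
  exists v, solution_path_in Phi J C v /\ forall s, u i s @[i --> G] --> v s.
Proof.
move=> cC uC up dd.
have /choice[v vP] : forall s, exists p : X, u i s @[i --> G] --> p.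
  move=> s; have [|p _ up_] := @ultra_limit _ G UG _ setT (u^~ s) compactX.
    exact: nearW.
  by exists p.
exists v; split => //; split.
  move=> s t Js Jt st.
  apply: (semiflow_limit semiflow_Phi (vP s) (dd _ _ Js Jt st) (vP t)).
  exact: up.
by move=> _ [s Js <-]; apply: (closed_cvg C cC _ _ (vP s)); exact: uC.
Qed.

Lemma semiflow_chain n {h : R} {x y} : 0 <= h -> Phi (x, n%:R * h, y) ->
  exists c : nat -> X, [/\ c 0%N = x, c n = y &
    forall i j, (i <= j <= n)%N -> Phi (c i, (j%:R - i%:R) * h, c j)].
Proof.
move=> h0; elim: n x => [|n IHn] x.
  rewrite mul0r => /(semiflow_refl_eq semiflow_Phi) <-.
  exists (fun=> x); split => // i j /andP[]; rewrite leqn0 => + /eqP j0.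
  by rewrite j0 leqn0 => /eqP ->; rewrite subrr mul0r; exact: semiflow_refl.
have -> : n.+1%:R * h = h + n%:R * h by rewrite -natr1 mulrDl mul1r addrC.
move=> /(semiflow_split semiflow_Phi h0)[|z xz /IHn[c [c0 cn cP]]].
  by rewrite mulr_ge0.
exists (fun k => if k is k'.+1 then c k' else x); split => // -[|i] [|j] //.
- by move=> _; rewrite subrr mul0r; exact: semiflow_refl.
- move=> /andP[_ jn]; rewrite subr0 -natr1 mulrDl mul1r addrC.
  apply: (semiflow_trans semiflow_Phi xz).
  by rewrite -c0 -[j%:R]subr0; exact: cP.
- by rewrite !ltnS => ijn; rewrite -!natr1 opprD addrACA subrr addr0; exact: cP.
Qed.

Lemma floor_grid_cvg (s t : R) : 0 <= s -> 0 < t ->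
  (Num.truncn (s * n.+1%:R / t))%:R * (t / n.+1%:R) @[n --> \oo] --> s.
Proof.
move=> s0 t0.
apply: (@squeeze_cvgr _ _ _ _ (fun n => s - t / n.+1%:R) (fun=> s)).
- apply: nearW => n; have n0 : (0 : R) < n.+1%:R by rewrite ltr0n.
  have /truncn_itv/andP[h1 h2] : 0 <= s * n.+1%:R / t.
    by rewrite divr_ge0 ?mulr_ge0// ltW.
  set k := Num.truncn _ in h1 h2 *.
  have e0 : 0 < t / n.+1%:R by rewrite divr_gt0.
  have es : s * n.+1%:R / t * (t / n.+1%:R) = s.
    by rewrite mulrA divfK ?gt_eqF// mulfK ?gt_eqF.
  rewrite -(ler_pM2r e0) es in h1; rewrite -(ltr_pM2r e0) es in h2.
  move: h2; rewrite -natr1 mulrDl mul1r => h2; rewrite h1 andbT.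
  by rewrite lerBlDr ltW.
- rewrite -[X in _ --> X]subr0; apply: cvgB; first exact: cvg_cst.
  rewrite -[X in _ --> X](mulr0 t); apply: cvgM; first exact: cvg_cst.
  exact: cvg_harmonic.
- exact: cvg_cst.
Qed.

(** Cut the duration [t] into [n.+1] equal steps, choose a chain of points
    along this subdivision, and let [n] grow: the step functions through these
    chains have a limit path. *)
Lemma semiflow_path {x t y} : Phi (x, t, y) -> restriction Phi setT (x, t, y).
Proof.
move=> xy; have t0 := semiflow_time_ge0 semiflow_Phi xy.
split => //; move: t0; rewrite le_eqVlt => /predU1P[t0|t0].
  exists (fun=> x); split => //; last first.
    by apply: (semiflow_refl_eq semiflow_Phi); rewrite t0.
  split => // a b /=; rewrite -t0 !in_itv/=.
  move=> /andP[a0 a1] /andP[b0 b1]; lra.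
have /choice[c cP] : forall n, exists c : nat -> X, [/\ c 0%N = x, c n.+1 = y &
    forall i j, (i <= j <= n.+1)%N ->
      Phi (c i, (j%:R - i%:R) * (t / n.+1%:R), c j)].
  move=> n; apply: semiflow_chain; first by rewrite divr_ge0// ltW.
  by rewrite mulrCA divff ?mulr1// pnatr_eq0.
have [G [UG sG]] := sequence_ultra.
pose k n (s : R) := Num.truncn (s * n.+1%:R / t).
have ktop n : k n t = n.+1 by rewrite /k mulrAC divff ?gt_eqF// mul1r natrK.
have kmono n : {homo k n : a b / a <= b >-> (a <= b)%N}.
  move=> a b ab; apply: le_truncn.
  by rewrite ler_pM2r ?invr_gt0// ler_pM2r// ltr0n.
have [//|||v [vp vl]] := @limit_path _ G UG `[0, t]%classic setT
   (fun n s => c n (k n s))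
   (fun n a b => (k n b)%:R * (t / n.+1%:R) - (k n a)%:R * (t / n.+1%:R))
   closedT.
- by move=> s _; exact: nearW.
- move=> a b; rewrite /= !in_itv/= => /andP[a0 at_] /andP[b0 bt] ab.
  apply: nearW => n; rewrite -mulrBl; have [_ _] := cP n; apply.
  by rewrite kmono ?(ltW ab)//= -(ktop n) kmono.
- move=> a b; rewrite /= !in_itv/= => /andP[a0 at_] /andP[b0 bt] ab.
  apply: cvgB.
    exact: (cvg_trans (cvg_app _ sG) (floor_grid_cvg b0 t0)).
  exact: (cvg_trans (cvg_app _ sG) (floor_grid_cvg a0 t0)).
exists v; split => //.
- apply: (@cvg_unique _ (@metric_hausdorff _ X) _ _ _ _ (vl 0)).
  rewrite (_ : (fun n => _) = fun=> x); first exact: cvg_cst.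
  by apply/funext => n; rewrite /k mul0r mul0r truncn0; have [] := cP n.
- apply: (@cvg_unique _ (@metric_hausdorff _ X) _ _ _ _ (vl t)).
  rewrite (_ : (fun n => _) = fun=> y); first exact: cvg_cst.
  by apply/funext => n; rewrite ktop; have [] := cP n.
Qed.

(** The paths are defined on the varying intervals [[0, t_ i]]. Extending them
    by constants, that is, precomposing with [Num.min ^~ (t_ i)], makes a limit
    on [[0, t]] available. *)
Lemma restriction_limit {C : set X} {I : Type} {G : set_system I}
    {UG : UltraFilter G} (x_ : I -> X) (t_ : I -> R) (y_ : I -> X) x t y :
  closed C -> x_ @ G --> x -> t_ @ G --> t -> y_ @ G --> y ->
  (\forall i \near G, restriction Phi C (x_ i, t_ i, y_ i)) ->
  restriction Phi C (x, t, y).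
Proof.
move=> cC xx tt yy H.
have t0 : 0 <= t.
  apply: (@closed_cvg _ _ G _ t_ _ (@closed_ge R 0) _ t tt).
  by apply: filterS H => i [].
have /choice[u uP] : forall i, exists u : R -> X,
    restriction Phi C (x_ i, t_ i, y_ i) ->
    [/\ solution_path_in Phi `[0, t_ i] C u, u 0 = x_ i & u (t_ i) = y_ i].
  move=> i.
  have [[_ [u uP]]|n] := pselect (restriction Phi C (x_ i, t_ i, y_ i)).
    by exists u.
  by exists (fun=> x).
have clip i s : restriction Phi C (x_ i, t_ i, y_ i) -> 0 <= s ->
    `[0, t_ i]%classic (Num.min s (t_ i)).
  by move=> [ti0 _] s0; rewrite /= in_itv/= le_min s0 ti0 ge_min lexx orbT.
have mcvg s : Num.min s (t_ i) @[i --> G] --> Num.min s t.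
  have ct : {for t, continuous ((fun=> s) \min (@id R) : R -> R^o)}.
    by apply: continuous_min => //; exact: cvg_cst.
  exact: (cvg_comp _ _ tt ct).
have [//|||v [vp vl]] := @limit_path _ G UG `[0, t]%classic C
   (fun i s => u i (Num.min s (t_ i)))
   (fun i a b => Num.min b (t_ i) - Num.min a (t_ i)) cC.
- move=> s; rewrite /= in_itv/= => /andP[s0 st].
  apply: filterS H => i Hi; have [[_ uC] _ _] := uP i Hi.
  by apply: uC; exists (Num.min s (t_ i)) => //; exact: clip.
- move=> a b; rewrite /= !in_itv/= => /andP[a0 at_] /andP[b0 bt] ab.
  apply: filterS H => i Hi; have [[up _] _ _] := uP i Hi.
  apply: (solution_path_le semiflow_Phi up); [exact: clip|exact: clip|].
  by rewrite le_min2// ltW.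
- move=> a b; rewrite /= !in_itv/= => /andP[a0 at_] /andP[b0 bt] ab.
  have -> : b - a = Num.min b t - Num.min a t by rewrite !min_l.
  by apply: cvgB; exact: mcvg.
split => //; exists v; split => //.
- apply/esym/(semiflow_refl_eq semiflow_Phi).
  apply: (semiflow_limit semiflow_Phi xx (cvg_cst 0) (vl 0)).
  apply: filterS H => i Hi; have [_ u0 _] := uP i Hi.
  case: Hi => ti0 _; rewrite min_l// u0; exact: semiflow_refl.
- apply: (semiflow_refl_eq semiflow_Phi).
  have tt0 : t_ i - Num.min t (t_ i) @[i --> G] --> (0 : R).
    by have := cvgB tt (mcvg t); rewrite minxx subrr; exact.
  apply: (semiflow_limit semiflow_Phi (vl t) tt0 yy).
  apply: filterS H => i Hi; have [[up _] _ <-] := uP i Hi.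
  have [ti0 _] := Hi.
  apply: (solution_path_le semiflow_Phi up); first exact: clip.
    by rewrite /= in_itv/= ti0 lexx.
  by rewrite ge_min lexx orbT.
Qed.

(** It is enough that the paths [u i] are defined further and further back. *)
Lemma minus_viable_limit {C : set X} {I : Type} {G : set_system I}
    {UG : UltraFilter G} (u : I -> R -> X) (y_ : I -> X) y :
  closed C -> y_ @ G --> y ->
  (forall M, \forall i \near G,
     solution_path_in Phi `[- M, 0] C (u i) /\ u i 0 = y_ i) ->
  minus_viable_part Phi C y.
Proof.
move=> cC yy H.
have [//|||v [vp vl]] := @limit_path _ G UG `]-oo, 0]%classic C u
   (fun i a b => b - a) cC.
- move=> s; rewrite /= in_itv/= => s0.
  apply: filterS (H (- s)) => i [[_ uC] _]; apply: uC; exists s => //=.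
  by rewrite in_itv/= opprK lexx.
- move=> a b; rewrite /= !in_itv/= => a0 b0 ab.
  apply: filterS (H (- a)) => i [[up _] _]; apply: up => //=.
    by rewrite in_itv/= opprK lexx.
  by rewrite in_itv/= opprK ltW.
- by move=> *; exact: cvg_cst.
exists v; split => //.
apply: (semiflow_refl_eq semiflow_Phi).
apply: (semiflow_limit semiflow_Phi (vl 0) (cvg_cst 0) yy).
by apply: filterS (H 0) => i [_ <-]; exact: semiflow_refl.
Qed.

Lemma restriction_limit_infty {C : set X} {I : Type} {G : set_system I}
    {UG : UltraFilter G} (x_ : I -> X) (t_ : I -> R) (y_ : I -> X) y :
  closed C -> (forall M, \forall i \near G, M <= t_ i) -> y_ @ G --> y ->
  (\forall i \near G, restriction Phi C (x_ i, t_ i, y_ i)) ->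
  minus_viable_part Phi C y.
Proof.
move=> cC tt yy H.
have /choice[u uP] : forall i, exists u : R -> X,
    restriction Phi C (x_ i, t_ i, y_ i) ->
    solution_path_in Phi `[0, t_ i] C u /\ u (t_ i) = y_ i.
  move=> i.
  have [[_ [u [up _ uy]]]|n] := pselect (restriction Phi C (x_ i, t_ i, y_ i)).
    by exists u.
  by exists (fun=> y).
apply: (@minus_viable_limit _ _ G _ (fun i s => u i (s + t_ i)) y_) => // M.
apply: filterS2 H (tt M) => i /uP[up uy] Mt; rewrite add0r; split => //.
apply: (solution_path_shift (a := t_ i) up) => s /=; rewrite !in_itv/=; lra.
Qed.

(** The second disjunct alone does not define a closed relation, because times
    may tend to infinity; by [restriction_limit_infty] the limit points lost in
    this way have their second component in [C_-]. *)
Definition late (C : set X) (tau : R) : set (X * X) :=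
  [set p | minus_viable_part Phi C p.2 \/
     exists2 t, tau <= t & restriction Phi C (p.1, t, p.2)].

Lemma minus_viable_closed (C : set X) : closed C ->
  closed (minus_viable_part Phi C).
Proof.
move=> cC; apply: closed_ultra => G p UG GE Gp.
have /choice[u uP] : forall x, exists u : R -> X, minus_viable_part Phi C x ->
    solution_path_in Phi `]-oo, 0] C u /\ u 0 = x.
  move=> x; have [[u uP]|n] := pselect (minus_viable_part Phi C x).
    by exists u.
  by exists (fun=> x).
apply: (@minus_viable_limit _ _ G _ u id) => // M.
apply: filterS GE => x /uP[up ux]; split => //.
by apply: solution_path_sub up => // s /=; rewrite !in_itv/= => /andP[].
Qed.

(** Along an ultrafilter the times are either bounded, hence convergent, or
    tend to infinity. *)
Lemma late_closed (C : set X) tau : closed C -> closed (late C tau).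
Proof.
move=> cC; apply: closed_ultra => G p UG GE Gp.
have p1 : fst @ G --> p.1 by exact: cvg_comp _ _ Gp cvg_fst.
have p2 : snd @ G --> p.2 by exact: cvg_comp _ _ Gp cvg_snd.
have [Gm|Gm] := in_ultra_setVsetC [set q | minus_viable_part Phi C q.2] UG.
  left; exact: (closed_cvg _ (minus_viable_closed cC) Gm _ p2).
have /choice[t tP] : forall q : X * X, exists t, late C tau q ->
    ~ minus_viable_part Phi C q.2 ->
    tau <= t /\ restriction Phi C (q.1, t, q.2).
  move=> q; have [[m|[t tau_t r]]|n] := pselect (late C tau q).
  - by exists 0.
  - by exists t.
  - by exists 0.
have H : \forall q \near G, tau <= t q /\ restriction Phi C (q.1, t q, q.2).
  by apply: filterS2 GE Gm => q lq nq; exact: tP.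
have Ht : \forall q \near G, tau <= t q by apply: filterS H => q [].
have Hr : \forall q \near G, restriction Phi C (q.1, t q, q.2).
  by apply: filterS H => q [].
have [[M HM]|nM] := pselect (exists M, \forall q \near G, t q <= M).
  have [|t0 _ tt0] := @ultra_limit _ G UG _ `[0, M]%classic t
    (segment_compact (a := 0) (b := M)).
    by apply: filterS2 HM Hr => q qM [q0 _]; rewrite /= in_itv/= q0.
  right; exists t0; last exact: (restriction_limit cC p1 tt0 p2).
  exact: (@closed_cvg _ _ G _ t _ (@closed_ge R tau) Ht _ tt0).
left; apply: (restriction_limit_infty cC _ p2 Hr) => M.
have [GM|] := in_ultra_setVsetC [set q | t q <= M] UG.
  by exfalso; apply: nM; exists M.
by apply: filterS => q /= /negP; rewrite -ltNge => /ltW.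
Qed.

(** Otherwise points outside [O] are reached at times tending to infinity; a
    limit of these would be in [C_-], but not in [O]. *)
Lemma late_near (C O : set X) : closed C -> open O ->
  minus_viable_part Phi C `<=` O ->
  exists2 tau : R, 0 < tau & forall p, late C tau p -> O p.2.
Proof.
move=> cC oO mO; apply: contrapT => H.
have /choice[p pP] : forall n : nat, exists p, late C n.+1%:R p /\ ~ O p.2.
  move=> n; apply: contrapT => Hn; apply: H.
  exists n.+1%:R; first by rewrite ltr0n.
  by move=> p lp; apply: contrapT => np; apply: Hn; exists p.
have /choice[t tP] : forall n : nat, exists t, n.+1%:R <= t /\
    restriction Phi C ((p n).1, t, (p n).2).
  move=> n; have [[/mO//|[t ? ?]] _] := pP n; by exists t.
have [G [UG sG]] := sequence_ultra.
have [|y _ py] := @ultra_limit _ G UG _ setT (fun n => (p n).2) compactX.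
  exact: nearW.
have nOy : (~` O) y.
  apply: (closed_cvg (~` O) _ _ _ py); first exact: open_closedC.
  by apply: nearW => n; have [] := pP n.
apply: nOy; apply: mO.
apply: (restriction_limit_infty (x_ := fun n => (p n).1) (t_ := t) cC _ py)
  => [M|]; last first.
  by apply: nearW => n; have [] := tP n.
apply: sG; exists (Num.truncn M) => //= n /= Mn.
have [+ _] := tP n; apply: le_trans.
by apply: ltW; apply: lt_le_trans (truncnS_gt M) _; rewrite ler_nat.
Qed.

Lemma late_comp (C : set X) s t x y z : 
  late C s (x, y) -> late C t (y, z) -> late C (s + t) (x, z).
Proof.
move=> /= + [|[b tb yz]]; last first; first last.
  by move=> ? ?; left.
move=> [xy|[a sa xy]].
  by left; exact: (minus_viable_invariant semiflow_Phi xy yz).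
right; exists (a + b); first exact: lerD.
exact: (restriction_trans semiflow_Phi xy yz).
Qed.

End CompactPaths.

(** * Neighborhoods moved into their interior *)

Section ClosedRelations.
Context {R : realType} {X : metricType R}.
Hypothesis compactX : compact [set: X].
Implicit Types (F : set (X * X)) (K O : set X).

Let compact_rel (E : set (X * X)) : closed E -> compact E.
Proof.
move=> cE; apply: (subclosed_compact cE (compact_setX compactX compactX)).
by move=> p _; split.
Qed.

Let closed_image (f : X * X -> X) (E : set (X * X)) :
  continuous f -> closed E -> closed (f @` E).
Proof.
move=> cf cE; apply: compact_closed; first exact: metric_hausdorff.
apply: continuous_compact (compact_rel cE).
exact: continuous_subspaceT.
Qed.

Lemma relation_image_closed F K : closed F -> closed K ->
  closed (relation_image F K).
Proof.
move=> cF cK.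
have -> : relation_image F K = snd @` (F `&` fst @^-1` K).
  apply/seteqP; split => [y [x Kx Fxy]|_ [[x y] [/= Fxy Kx] <-]].
    by exists (x, y).
  by exists x.
apply: closed_image; first by move=> p; exact: cvg_snd.
apply: closedI => //; apply: preimage_closed => // p _; exact: cvg_fst.
Qed.

(** The complement is the projection of a closed subset of the compact space
    [X * X]. *)
Lemma forward_core_open F O : closed F -> open O ->
  open [set x | forall y, F (x, y) -> O y].
Proof.
move=> cF oO; rewrite -closedC.
have -> : ~` [set x | forall y, F (x, y) -> O y] =
    fst @` (F `&` snd @^-1` (~` O)).
  apply/seteqP; split => [x /= /existsNP[y /not_implyP[Fxy nOy]]|].
    by exists (x, y).
  by move=> _ [[x y] [/= Fxy nOy] <-] /(_ _ Fxy).
apply: closed_image; first by move=> p; exact: cvg_fst.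
apply: closedI => //; apply: preimage_closed; last exact: open_closedC.
by move=> p _; exact: cvg_snd.
Qed.

Definition invariant F K := relation_image F K `<=` K.

Lemma closed_neighborhood K O : closed K -> open O -> K `<=` O ->
  exists Q, [/\ closed Q, K `<=` Q° & Q `<=` O].
Proof.
move=> cK oO KO.
have : set_nbhs K O by apply/set_nbhsP; exists O; split.
case/(compact_normal (@metric_hausdorff _ X) compactX cK) => W.
move=> /set_nbhsP[W' [oW' KW' W'W]] WO.
exists (closure W); split => //; first exact: closed_closure.
apply: subset_trans KW' _; rewrite -open_subsetE//.
by apply: (subset_trans W'W); exact: subset_closure.
Qed.

(** The open set [O'] of points of [O] whose image is inside [O] contains the
    image of each of its points, by transitivity. So a closed neighborhood
    [N] of [K] inside [O'] may be saturated without leaving [O]. *)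
Lemma invariant_neighborhood F K O : closed F ->
  (forall x y z, F (x, y) -> F (y, z) -> F (x, z)) ->
  closed K -> invariant F K -> open O -> K `<=` O ->
  exists Q, [/\ closed Q, invariant F Q, K `<=` Q° & Q `<=` O].
Proof.
move=> cF trF cK iK oO KO.
pose O' := O `&` [set x | forall y, F (x, y) -> O y].
have [||N [cN KN NO']] := @closed_neighborhood K O' cK.
- by apply: openI => //; exact: forward_core_open.
- move=> x Kx; split; first exact: KO.
  by move=> y Fxy; apply/KO/iK; exists x.
exists (N `|` relation_image F N); split.
- by apply: closedU => //; exact: relation_image_closed.
- move=> z [y [Ny|[x Nx Fxy]] Fyz]; right; first by exists y.
  by exists x => //; exact: trF Fyz.
- by apply: subset_trans KN _; apply: interiorS => x; left.
- move=> y [/NO'[]//|[x /NO'[_]]]; exact.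
Qed.

End ClosedRelations.

Section InwardNeighborhood.
Context {R : realType} {X : metricType R}.
Variable F : R -> set (X * X).
Hypotheses (compactX : compact [set: X])
  (F_closed : forall t, closed (F t))
  (F_comp : forall s t x y z, F s (x, y) -> F t (y, z) -> F (s + t) (x, z))
  (F_decreasing : forall s t, s <= t -> F t `<=` F s).

Let F0_trans x y z : F 0 (x, y) -> F 0 (y, z) -> F 0 (x, z).
Proof. by move=> Fxy Fyz; rewrite -[0]addr0; exact: F_comp Fyz. Qed.

Let thicken K O : closed K -> invariant (F 0) K -> open O -> K `<=` O ->
  exists Q, [/\ closed Q, invariant (F 0) Q, K `<=` Q° & Q `<=` O].
Proof.
move=> *.
by apply: (invariant_neighborhood compactX (@F_closed 0) F0_trans).
Qed.

Lemma relation_image_invariant t K : 0 <= t ->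
  invariant (F 0) (relation_image (F t) K).
Proof.
move=> t0 z [y [x Kx Fxy] Fyz]; exists x => //.
by rewrite -[t]addr0; exact: F_comp Fyz.
Qed.

Lemma invariant_image_sub t K : 0 <= t -> invariant (F 0) K ->
  relation_image (F t) K `<=` K.
Proof.
move=> t0 iK y [x Kx Fxy]; apply: iK; exists x => //.
exact: F_decreasing Fxy.
Qed.

Lemma invariantU K Q : invariant (F 0) K -> invariant (F 0) Q ->
  invariant (F 0) (K `|` Q).
Proof.
by move=> iK iQ y [x [Kx|Qx] Fxy]; [left; apply: iK|right; apply: iQ]; exists x.
Qed.

(** The pairs [(A_n, B_n)] that sandwich the final neighborhood; [P.1] is the
    inner set. *)
Record inward_pair (t : R) (P : set X * set X) : Prop := {
  inward_closed1 : closed P.1;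
  inward_closed2 : closed P.2;
  inward_inv1 : invariant (F 0) P.1;
  inward_inv2 : invariant (F 0) P.2;
  inward_sub : P.1 `<=` P.2°;
  inward_image : relation_image (F t) P.2 `<=` P.1 }.

(** Here [P = (A, B)], and [Q] is an invariant neighborhood of [A] inside [B].
    The image [N] of [Q] at time [t / 2] may leave the interior of [Q], but the
    image of [N] at time [t / 2] is in [A], hence inside [Q], and this persists
    for a small neighborhood [L] of [N]. So at time [t / 2] the union of [Q] and
    [L] is moved into its interior: [Q] goes into [L], and [L] into [Q]. *)
Lemma inward_pair_refine t P : 0 <= t -> inward_pair t P ->
  exists P', [/\ inward_pair (t / 2) P', P.1 `<=` P'.1° & P'.2 `<=` P.2].
Proof.
case: P => A B t0 [/= cA cB iA iB AB FBA].
have t20 : 0 <= t / 2 by rewrite divr_ge0.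
have [Q [cQ iQ AQ QB]] := thicken cA iA (open_interior B) AB.
pose N := relation_image (F (t / 2)) Q.
have NB : N `<=` B° by apply: subset_trans (invariant_image_sub t20 iQ) _.
have [||||L [cL iL NL LO]] := @thicken N
    (B° `&` [set x | forall y, F (t / 2) (x, y) -> Q° y]).
- exact: relation_image_closed.
- exact: relation_image_invariant.
- apply: openI; first exact: open_interior.
  by apply: forward_core_open => //; exact: open_interior.
- move=> y Ny; split; first exact: NB.
  move=> z Fyz; apply/AQ/FBA; case: Ny => x Qx Fxy; exists x.
    by apply: interior_subset; exact: QB.
  by rewrite [t]splitr; exact: F_comp Fyz.
have cQL : closed (Q `|` L) by exact: closedU.
have iQL : invariant (F 0) (Q `|` L) by exact: invariantU.
have FQL : relation_image (F (t / 2)) (Q `|` L) `|` A `<=` (Q `|` L)°.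
  move=> y [[x [Qx|Lx] Fxy]|Ay].
  - suff : L° y by apply: interiorS => ?; right.
    by apply: NL; exists x.
  - suff : Q° y by apply: interiorS => ?; left.
    by have [_] := LO _ Lx; apply.
  - by have : Q° y by [exact: AQ]; apply: interiorS => ?; left.
have [||A' [cA' iA' AA' A'QL]] := thicken _ _ (open_interior (Q `|` L)) FQL.
- by apply: closedU => //; exact: relation_image_closed.
- by apply: invariantU => //; exact: relation_image_invariant.
exists (A', Q `|` L); split => /=.
- split => //=; apply: subset_trans (@interior_subset _ _).
  by apply: subset_trans AA' => y; left.
- by apply: subset_trans AA' => y; right.
- by move=> x [/QB/interior_subset//|/LO[/interior_subset]].
Qed.

(** Refining an initial pair again and again yields pairs [S n] for the times
    [tau n = t0 / 2 ^+ n]. The intersection of the outer sets contains every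
    inner set, and even in its interior since the inner sets increase
    strictly. *)
Lemma inward_neighborhood K U : closed K -> invariant (F 0) K ->
  (forall O, open O -> K `<=` O ->
    exists2 t, 0 < t & forall p, F t p -> O p.2) ->
  open U -> K `<=` U ->
  exists P, [/\ closed P, K `<=` P°, P `<=` U, relation_image (F 0) P `<=` P &
    forall t, 0 < t -> relation_image (F t) P `<=` P°].
Proof.
move=> cK iK FK oU KU.
have [B [cB iB KB BU]] := thicken cK iK oU KU.
have [A [cA iA KA AB]] := thicken cK iK (open_interior B) KB.
have [t0 t0_gt0 Ft0] := FK _ (open_interior A) KA.
pose tau n : R := t0 / 2 ^+ n.
have tau0 n : 0 <= tau n by rewrite divr_ge0 ?exprn_ge0// ltW.
have pair0 : inward_pair (tau 0%N) (A, B).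
  split => //= y [x _ Fxy]; rewrite /tau expr0 divr1 in Fxy.
  by apply: interior_subset; exact: Ft0 Fxy.
have /choice[next nextP] : forall q : nat * (set X * set X), exists P',
    inward_pair (tau q.1) q.2 ->
    [/\ inward_pair (tau q.1.+1) P', q.2.1 `<=` P'.1° & P'.2 `<=` q.2.2].
  move=> [n q]; have [qP|nq] := pselect (inward_pair (tau n) q); last first.
    by exists q => /nq.
  have [P' [? ? ?]] := inward_pair_refine (tau0 n) qP.
  exists P' => _; split => //.
  by rewrite /= /tau exprSr invfM mulrA.
pose S := fix S n := if n is m.+1 then next (m, S m) else (A, B).
have SP n : inward_pair (tau n) (S n).
  by elim: n => [//|n IHn]; have [] := nextP (n, S n) IHn.
have Sup n : (S n).1 `<=` (S n.+1).1° by have [] := nextP (n, S n) (SP n).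
have Sdown n : (S n.+1).2 `<=` (S n).2 by have [] := nextP (n, S n) (SP n).
have S1 m n : (m <= n)%N -> (S m).1 `<=` (S n).1.
  elim: n => [|n IHn]; first by rewrite leqn0 => /eqP ->.
  rewrite leq_eqVlt => /predU1P[->//|/IHn mn].
  exact: subset_trans mn (subset_trans (Sup n) (@interior_subset _ _)).
have S2 m n : (m <= n)%N -> (S n).2 `<=` (S m).2.
  elim: n => [|n IHn]; first by rewrite leqn0 => /eqP ->.
  rewrite leq_eqVlt => /predU1P[->//|/IHn mn].
  exact: subset_trans (Sdown n) mn.
have S12 m n : (S m).1 `<=` (S n).2.
  apply: subset_trans (S1 _ _ (leq_maxl m n)) _.
  apply: subset_trans (S2 _ _ (leq_maxr m n)).
  exact: subset_trans (inward_sub (SP _)) (@interior_subset _ _).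
pose P := \bigcap_n (S n).2.
have S1P n : (S n).1 `<=` P°.
  by apply: subset_trans (Sup n) _; apply: interiorS => x Sx k _; exact: S12 Sx.
exists P; split.
- by apply: closed_bigI => n _; exact: inward_closed2 (SP n).
- apply: subset_trans (S1P 0%N); exact: subset_trans KA (@interior_subset _ _).
- by move=> x /(_ 0%N Logic.I)/= /BU.
- move=> y [x Px Fxy] n _; apply: (inward_inv2 (SP n)); exists x => //.
  exact: Px.
- move=> t t_gt0 y [x Px Fxy].
  have [n tn] : exists n, tau n <= t.
    exists (Num.truncn (t0 / t)); rewrite /tau ler_pdivrMr ?exprn_gt0//.
    rewrite mulrC -ler_pdivrMr//.
    apply: le_trans (ltW (truncnS_gt _)) _.
    by rewrite -natrX ler_nat ltn_expl.
  apply: (S1P n); apply: (inward_image (SP n)); exists x; first exact: Px.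
  exact: F_decreasing Fxy.
Qed.

End InwardNeighborhood.

(** * Time reversal *)

Section Reverse.
Context {R : realType} {X : metricType R}.
Implicit Types (Phi : set (X * R * X)) (C : set X).

Lemma reverseK Phi : reverse (reverse Phi) = Phi.
Proof. by apply/funext => -[[x t] y]. Qed.

Lemma semiflow_reverse Phi :
  semiflow_relation Phi -> semiflow_relation (reverse Phi).
Proof.
move=> sPhi; split.
- by move=> x t y /(semiflow_time_ge0 sPhi).
- apply: closed_ultra => G [[y t] x] UG GE Gp.
  have cy : (fun q : X * R * X => q.1.1) @ G --> y.
    exact: cvg_comp _ _ (cvg_comp _ _ Gp cvg_fst) cvg_fst.
  have ct : (fun q : X * R * X => q.1.2) @ G --> t.
    exact: cvg_comp _ _ (cvg_comp _ _ Gp cvg_fst) cvg_snd.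
  have cx : snd @ G --> x by exact: cvg_comp _ _ Gp cvg_snd.
  by apply: (semiflow_limit sPhi cx ct cy); apply: filterS GE => -[[]].
- apply/seteqP; split => -[x y] /=.
    by move=> yx; apply/esym/(semiflow_refl_eq sPhi).
  by move=> /diagonalP ->; exact: (semiflow_refl sPhi).
- move=> s t s0 t0; apply/seteqP; split => -[x y] /=.
    by move=> [z xz zy]; exact: (semiflow_trans sPhi zy xz).
  by move=> /(semiflow_split sPhi s0 t0)[z ? ?]; exists z.
Qed.

Lemma solution_path_reverse Phi (I J : set R) C (u : R -> X) a :
  solution_path_in Phi I C u -> (forall s, J s -> I (a - s)) ->
  solution_path_in (reverse Phi) J C (fun s => u (a - s)).
Proof.
move=> [pu uC] JI; split.
  move=> s t Js Jt st; rewrite /reverse /=.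
  have -> : t - s = (a - s) - (a - t) by lra.
  by apply: pu; [exact: JI|exact: JI|lra].
by move=> _ [s Js <-]; apply: uC; exists (a - s) => //; exact: JI.
Qed.

Let restriction_reverse_sub Phi C x t y :
  restriction Phi C (x, t, y) -> restriction (reverse Phi) C (y, t, x).
Proof.
move=> [t0 [u [pu u0 ut]]]; split => //; exists (fun s => u (t - s)).
split; rewrite ?subrr ?subr0//.
by apply: (solution_path_reverse pu) => s /=; rewrite !in_itv/=; lra.
Qed.

Lemma restriction_reverse Phi C x t y :
  restriction (reverse Phi) C (y, t, x) <-> restriction Phi C (x, t, y).
Proof.
split; last exact: restriction_reverse_sub.
by move=> /restriction_reverse_sub; rewrite reverseK.
Qed.

Lemma plus_viable_reverse Phi C :
  plus_viable_part (reverse Phi) C = minus_viable_part Phi C.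
Proof.
apply/seteqP; split => x [u [pu u0]]; exists (fun s => u (0 - s)).
  split; last by rewrite subr0.
  rewrite -[Phi]reverseK.
  by apply: (solution_path_reverse pu) => s /=; rewrite !in_itv/=; lra.
split; last by rewrite subr0.
by apply: (solution_path_reverse pu) => s /=; rewrite !in_itv/=; lra.
Qed.

Lemma minus_viable_reverse Phi C :
  minus_viable_part (reverse Phi) C = plus_viable_part Phi C.
Proof. by rewrite -plus_viable_reverse reverseK. Qed.

Lemma viable_part_reverse Phi C :
  viable_part (reverse Phi) C = viable_part Phi C.
Proof.
by rewrite /viable_part plus_viable_reverse minus_viable_reverse setIC.
Qed.

End Reverse.

(** * Backward orbits and exit sets *)

Section BackwardLimits.
Context {R : realType} {X : metricType R} (Phi : set (X * R * X)).
Hypotheses (compactX : compact [set: X]) (semiflow_Phi : semiflow_relation Phi).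

(** The shifts of a backward path by [n] are paths on [(-oo, n]], and these
    have a limit path defined on the whole line. *)
Lemma backward_limit (C : set X) x : closed C -> minus_viable_part Phi C x ->
  exists (G : set_system nat) (z : nat -> X) y,
    [/\ UltraFilter G, z @ G --> y, viable_part Phi C y &
        forall n, restriction Phi C (z n, n%:R, x)].
Proof.
move=> cC [u [pu u0]]; have [G [UG sG]] := sequence_ultra.
have Gbig (s : R) : \forall n \near G, s <= n%:R.
  apply: sG; exists (Num.truncn s).+1 => // n /= sn.
  by apply: ltW; apply: lt_le_trans (truncnS_gt s) _; rewrite ler_nat.
have [//|||v [vp vl]] := @limit_path _ _ _ compactX semiflow_Phi _ G UG setT C
   (fun n s => u (s - n%:R)) (fun n a b => b - a) cC.
- move=> s _; apply: filterS (Gbig s) => n sn; have [_ uC] := pu.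
  by apply: uC; exists (s - n%:R) => //=; rewrite in_itv/=; lra.
- move=> a b _ _ ab; apply: filterS (Gbig b) => n bn; have [up _] := pu.
  have -> : b - a = (b - n%:R) - (a - n%:R) by lra.
  by apply: up; rewrite /= ?in_itv/=; lra.
- by move=> *; exact: cvg_cst.
exists G, (fun n => u (0 - n%:R)), (v 0); split => //.
  by split; exists v; split => //; exact: solution_path_sub vp.
move=> n; have n0 : (0 : R) <= n%:R by [].
rewrite -u0 -[X in restriction _ _ (_, X, _)](_ : 0 - (0 - n%:R) = n%:R);
  last lra.
by apply: (restriction_path pu) => [|s /andP[_ s0]]; [lra|rewrite /= in_itv].
Qed.

Lemma minus_viable_sub (C P : set X) : closed C ->
  plus_invariant (restriction Phi C) P -> viable_part Phi C `<=` P° ->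
  minus_viable_part Phi C `<=` P.
Proof.
move=> cC iP AP x /(backward_limit cC)[G [z [y [UG zy /AP Py zx]]]].
have /filter_ex[n Pn] : \forall n \near G, P (z n) by exact: zy.
exact: iP Pn (zx n).
Qed.

End BackwardLimits.

Section IsolatedSets.
Context {R : realType} {X : metricType R} (Phi : set (X * R * X)).
Hypotheses (compactX : compact [set: X]) (semiflow_Phi : semiflow_relation Phi).

Lemma plus_viable_disjoint (C P : set X) : closed C -> closed P ->
  plus_invariant (restriction Phi C) P ->
  viable_part Phi C `&` P = set0 -> plus_viable_part Phi C `&` P = set0.
Proof.
move=> cC cP iP AP; rewrite -subset0 => x [+ Px]; rewrite -minus_viable_reverse.
move=> /(backward_limit compactX (semiflow_reverse semiflow_Phi) cC).
move=> [G [z [y [UG zy Ay zx]]]]; rewrite viable_part_reverse in Ay.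
suff : (viable_part Phi C `&` P) y by rewrite AP.
split => //.
apply: (closed_cvg P cP _ _ zy); apply: nearW => n.
exact: iP Px ((restriction_reverse _ _ _ _ _).1 (zx n)).
Qed.

(** Otherwise the connecting paths meet the complement of [C] at times tending
    to 0; these exit points also tend to [x], which is interior to [C]. *)
Lemma short_path_inside (C : set X) {I : Type} {G : set_system I}
    {UG : UltraFilter G} (p_ : I -> X) (t_ : I -> R) (y_ : I -> X) x :
  C° x -> p_ @ G --> x -> t_ @ G --> 0 ->
  (\forall i \near G, Phi (p_ i, t_ i, y_ i)) ->
  \forall i \near G, restriction Phi C (p_ i, t_ i, y_ i).
Proof.
move=> Cx px t0 H.
have [//|Gn] := in_ultra_setVsetC
  [set i | restriction Phi C (p_ i, t_ i, y_ i)] UG.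
have /choice[z zP] : forall i, exists z : R * X, Phi (p_ i, t_ i, y_ i) ->
    ~ restriction Phi C (p_ i, t_ i, y_ i) ->
    [/\ 0 <= z.1 <= t_ i, Phi (p_ i, z.1, z.2) & ~ C z.2].
  move=> i; have [xy|n] := pselect (Phi (p_ i, t_ i, y_ i)); last first.
    by exists (0, x) => /n.
  have [r|nr] := pselect (restriction Phi C (p_ i, t_ i, y_ i)).
    by exists (0, x).
  have [ti0 [u [pu u0 ut]]] := semiflow_path compactX semiflow_Phi xy.
  have [s [sI nCs]] : exists s, `[0, t_ i]%classic s /\ ~ C (u s).
    apply: contrapT => Hn; apply: nr; split => //; exists u; split => //.
    split; first by case: pu.
    move=> _ [s sI <-]; apply: contrapT => nCs; apply: Hn; by exists s.
  exists (s, u s) => _ _; split => //=.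
  move: sI; rewrite /= in_itv/= => /andP[s0 st].
  rewrite -u0 -[X in Phi (_, X, _)]subr0.
  by apply: (solution_path_le semiflow_Phi (proj1 pu));
    rewrite /= ?in_itv/= ?lexx ?ti0 ?s0.
have Hz : \forall i \near G,
    [/\ 0 <= (z i).1 <= t_ i, Phi (p_ i, (z i).1, (z i).2) & ~ C (z i).2].
  by apply: filterS2 H Gn => i; exact: zP.
have [|y _ zy] := @ultra_limit _ G UG _ setT (fun i => (z i).2) compactX.
  exact: nearW.
have z0 : (fun i => (z i).1) @ G --> (0 : R).
  apply: (@squeeze_cvgr _ _ _ _ (fun=> 0) t_) => //; last exact: cvg_cst.
  by apply: filterS Hz => i [].
have xy : x = y.
  apply: (semiflow_refl_eq semiflow_Phi).
  by apply: (semiflow_limit semiflow_Phi px z0 zy); apply: filterS Hz => i [].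
have : (~` C°) y.
  apply: (closed_cvg (~` C°) _ _ _ zy); first exact/open_closedC/open_interior.
  by apply: filterS Hz => i [_ _ nC] /interior_subset.
by rewrite -xy.
Qed.

Lemma rho_mono (F G : set (X * X)) P : F `<=` G -> rho F P `<=` rho G P.
Proof.
by move=> FG; apply: closureS => y [[x Px /FG Gxy] nPy]; split => //; exists x.
Qed.

Lemma time_set_map_mono (e f : R) : e <= f ->
  time_set_map Phi `[0, e] `<=` time_set_map Phi `[0, f].
Proof.
move=> ef p [t /= te pt]; exists t => //=.
by move: te; rewrite !in_itv/= => /andP[-> /le_trans]; apply.
Qed.

(** A point [x] of [semiflow_delta Phi P] is a limit of points outside [P]
    reached from [P] in times tending to 0. Their origins also tend to [x], so
    [x] is in [P]; if [x] were interior to [C], the paths would eventually stay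
    in [C] and could not leave [P]. *)
Lemma semiflow_delta_boundary (C P : set X) : closed P -> P `<=` C ->
  plus_invariant (restriction Phi C) P ->
  semiflow_delta Phi P `<=` P `&` boundary C.
Proof.
move=> cP PC iP x dx.
have /choice[q qP] : forall n : nat, exists q : X * R * X,
    [/\ ball x n.+1%:R^-1 q.2, P q.1.1, 0 <= q.1.2 <= n.+1%:R^-1,
        Phi q & ~ P q.2].
  move=> n; have n0 : (0 : R) < n.+1%:R^-1 by rewrite invr_gt0.
  have [y [[[p Pp [t tI pty]] nPy] xy]] :=
    dx _ n0 (ball x n.+1%:R^-1) (nbhsx_ballx _ _ n0).
  by exists (p, t, y).
have [G [UG sG]] := sequence_ultra.
have h0 : n.+1%:R^-1 @[n --> G] --> (0 : R).
  exact: (cvg_trans (cvg_app _ sG) (@cvg_harmonic R)).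
have qx : (fun n => (q n).2) @ G --> x.
  apply/cvg_ballP => e e0.
  have : \forall n \near G, n.+1%:R^-1 < e by exact: (cvgr_lt _ h0).
  apply: filterS => n ne; have [+ _ _ _ _] := qP n.
  exact/le_ball/ltW.
have t0 : (fun n => (q n).1.2) @ G --> (0 : R).
  apply: (@squeeze_cvgr _ _ _ _ (fun=> 0) (fun n => n.+1%:R^-1)) => //.
    by apply: nearW => n; have [] := qP n.
  exact: cvg_cst.
have [|p Pp qp] := @ultra_limit _ G UG _ P (fun n => (q n).1.1)
    (subclosed_compact cP compactX (@subsetT _ _)).
  by apply: nearW => n; have [] := qP n.
have Hq : \forall n \near G, Phi ((q n).1.1, (q n).1.2, (q n).2).
  apply: nearW => n; by have [_ _ _ + _] := qP n; case: (q n) => -[].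
have px : p = x.
  apply: (semiflow_refl_eq semiflow_Phi).
  by apply: (semiflow_limit semiflow_Phi qp t0 qx).
subst p; split => //; split; first exact: PC.
move=> Cx.
have /filter_ex[n rn] := short_path_inside (UG := UG) Cx qp t0 Hq.
have [_ Pn _ _ nPn] := qP n.
by apply: nPn; exact: iP rn.
Qed.

(** A sequence of counterexamples for [e = 1 / n.+1] would accumulate at a
    point of [semiflow_delta Phi P] interior to [C]. *)
Lemma short_delta (C P Q : set X) : closed P -> P `<=` C ->
  plus_invariant (restriction Phi C) P ->
  closure (P `\` Q) `<=` C° ->
  exists2 e : R, 0 < e & delta (time_set_map Phi `[0, e]) P `<=` Q.
Proof.
move=> cP PC iP PQC; apply: contrapT => H.
have /choice[z zP] : forall n : nat, exists z,
    (P `\` Q) z /\ rho (time_set_map Phi `[0, n.+1%:R^-1]) P z.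
  move=> n; apply: contrapT => Hn; apply: H.
  exists n.+1%:R^-1; first by rewrite invr_gt0.
  move=> z [Pz rz]; apply: contrapT => nQz; apply: Hn; by exists z.
have [G [UG sG]] := sequence_ultra.
have [|x _ zx] := @ultra_limit _ G UG _ setT z compactX; first exact: nearW.
have clx : closure (P `\` Q) x.
  apply: (closed_cvg _ (@closed_closure _ _) _ _ zx).
  by apply: nearW => n; apply: subset_closure; have [] := zP n.
have [] : (P `&` boundary C) x; last by move=> _ [_]; apply; exact: PQC.
apply: semiflow_delta_boundary => // e e0.
apply: (closed_cvg _ (@closed_closure _ _) _ _ zx).
have h0 : n.+1%:R^-1 @[n --> G] --> (0 : R).
  exact: (cvg_trans (cvg_app _ sG) (@cvg_harmonic R)).
have : \forall n \near G, n.+1%:R^-1 < e by exact: (cvgr_lt _ h0).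
apply: filterS => n ne; have [_] := zP n.
by apply: rho_mono; apply: time_set_map_mono; exact: ltW.
Qed.

(** This is [inward_neighborhood] for the relations [late C t], which contract
    to [C_-] as [t] grows, by [late_near]. *)
Lemma strict_neighborhood (C U : set X) : closed C -> open U ->
  minus_viable_part Phi C `<=` U ->
  exists P, [/\ closed P, minus_viable_part Phi C `<=` P°, P `<=` U,
    plus_invariant (restriction Phi C) P &
    forall x t y, P x -> restriction Phi C (x, t, y) -> 0 < t -> P° y].
Proof.
move=> cC oU mU.
have [||||||||P [cP mP PU P0 Pt]] := @inward_neighborhood R X (late Phi C)
  compactX _ _ _ (minus_viable_part Phi C) U.
- by move=> t; exact: late_closed.
- exact: late_comp.
- move=> s t st [x y] [?|[r tr xy]]; [by left|right; exists r => //].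
  exact: le_trans tr.
- exact: minus_viable_closed.
- move=> y [x mx [//|[t _ xy]]].
  exact: (minus_viable_invariant semiflow_Phi mx xy).
- by move=> O oO mO; exact: late_near.
- exact: oU.
- exact: mU.
exists P; split => //.
  move=> x t y Px xy; apply: P0; exists x => //; right; exists t => //.
  by case: xy.
by move=> x t y Px xy t0; apply: (Pt t t0); exists x => //; right; exists t.
Qed.

End IsolatedSets.

(** Outside [V] the compact sets [C_-] and [C_+] are disjoint, so they are
    separated there by a closed neighborhood [W] of [C_+]. *)
Lemma isolating_block (R : realType) (X : metricType R) (Phi : set (X * R * X))
    (C U V : set X) : compact [set: X] -> semiflow_relation Phi -> closed C ->
  open U -> open V -> minus_viable_part Phi C `<=` U ->
  viable_part Phi C `<=` V ->
  exists P Q, [/\ closed P, closed Q, P `<=` U, P `&` Q `<=` V &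
   [/\ minus_viable_part Phi C `<=` P°, plus_viable_part Phi C `<=` Q°,
    plus_invariant (restriction Phi C) P,
    forall x t y, P x -> restriction Phi C (x, t, y) -> 0 < t -> P° y &
    forall x t y, Q y -> restriction Phi C (x, t, y) -> 0 < t -> Q° x]].
Proof.
move=> cX sPhi cC oU oV mU AV; have sPhi' := semiflow_reverse sPhi.
have cm : closed (minus_viable_part Phi C) by exact: minus_viable_closed.
have cp : closed (plus_viable_part Phi C).
  by rewrite -minus_viable_reverse; exact: minus_viable_closed.
have [||W [cW pW Wm]] := @closed_neighborhood _ _ cX (plus_viable_part Phi C)
    (~` (minus_viable_part Phi C `&` ~` V)) cp.
- by apply: closed_openC; apply: closedI => //; exact: open_closedC.
- by move=> x px [mx]; apply; exact: AV.
have [||P [cP mP PU iP sP]] := @strict_neighborhood _ _ Phi cX sPhi C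
    (U `&` (V `|` ~` W)) cC.
- by apply: openI => //; apply: openU => //; exact: closed_openC.
- move=> x mx; split; first exact: mU.
  have [Vx|nVx] := pselect (V x); [by left|right => /Wm].
  by apply.
have [||Q [cQ pQ QW iQ sQ]] := @strict_neighborhood _ _ (reverse Phi) cX sPhi' C
    W° cC.
- exact: open_interior.
- by rewrite minus_viable_reverse.
exists P, Q; split => //.
- by move=> x /PU[].
- by move=> x [/PU[_ [//|nWx]] /QW/interior_subset].
split => //; first by rewrite -minus_viable_reverse.
by move=> x t y Qy xy t0; apply: sQ Qy _ t0; apply/restriction_reverse.
Qed.

(** * Index pairs *)

Theorem theorem3p33 (R : realType) (X : metricType R) (Phi : set (X * R * X))
    (C A : set X)
    (compactX : compact [set: X])
    (semiflow_Phi : semiflow_relation Phi)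
    (viable_A : viable Phi A)
    (isolating_C : isolating_neighborhood Phi C A) :
  (forall P1 P2 : set X, index_pair Phi C A P1 P2 ->
    [/\ minus_viable_part Phi C `<=` P1,
        plus_viable_part Phi C `&` P2 = set0,
        semiflow_delta Phi P1 `<=` P1 `&` boundary C,
        P1 `&` boundary C `<=` P2 &
        closure (P1 `\` P2) `<=` C° ->
          exists2 e : R, 0 < e & delta (time_set_map Phi `[0, e]) P1 `<=` P2])
  /\
  (forall U V : set X, open U -> open V ->
    minus_viable_part Phi C `<=` U ->
    viable_part Phi C `<=` V -> V `<=` C ->
    exists C0 P1 P2 : set X,
      [/\ simple_isolating_neighborhood Phi C0,
          index_pair Phi C A P1 P2,
          P1 `<=` U,
          closure (P1 `\` P2) `<=` C0 /\ C0 `<=` V &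
          closure (P1 `\` P2) `<=` C°]).
Proof.
have [cC AE AC] := isolating_C; split.
  move=> P1 P2 [_ cP1 cP2 [P21 P1C] iP1 iP2 AP P12C].
  split.
  - by apply: minus_viable_sub => //; rewrite -AE => x /AP[].
  - apply: plus_viable_disjoint => //.
    by rewrite -AE -subset0 => x [/AP[_ nP2x] P2x].
  - exact: semiflow_delta_boundary.
  - move=> x [P1x [_ nCx]]; apply: contrapT => nP2x; apply: nCx.
    exact: P12C.
  - exact: short_delta.
move=> U V oU oV mU AV VC.
have [P [Q [cP cQ PU PQV [mP pQ iP sP sQ]]]] :=
  isolating_block compactX semiflow_Phi cC oU oV mU AV.
pose C0 := C `&` (P `&` Q); pose P1 := P `&` C; pose P2 := P1 `&` ~` Q°.
have VCo : V `<=` C° by rewrite -open_subsetE.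
have cC0 : closed C0 by apply: closedI => //; exact: closedI.
have C0V : C0 `<=` V by move=> x [_ /PQV].
have P12 : P1 `\` P2 `<=` C0.
  move=> x [[Px Cx] nP2x]; split => //; split => //; apply: interior_subset.
  by apply: contrapT => nQx; apply: nP2x.
have clC0 : closure (P1 `\` P2) `<=` C0.
  by move/closure_id: cC0 => ->; exact: closureS.
have AP : viable_part Phi C `<=` P° by move=> x [_ /mP].
have AQ : viable_part Phi C `<=` Q° by move=> x [/pQ].
have sub0 x t y : restriction Phi C0 (x, t, y) -> restriction Phi C (x, t, y).
  move=> [t0 [u [pu u0 ut]]]; split => //; exists u; split => //.
  by apply: solution_path_sub pu => // z [].
exists C0, P1, P2; split.
- split.
    split => //; rewrite /C0 !interiorI => x Ax.
    have Ax' : viable_part Phi C x by apply: viable_part_mono Ax => z [].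
    by split; [exact/VCo/AV|split; [exact: AP|exact: AQ]].
  move=> x [C0x nC0x].
  (* In [V] the set [C] has no boundary, so [x] is on that of [P] or [Q]. *)
  have [PQx|nPQx] := pselect (P° x /\ Q° x).
    by exfalso; apply: nC0x; rewrite /C0 !interiorI; split => //; exact/VCo/C0V.
  have [Px|nPx] := pselect (P° x).
    left => t y xy; have [_ _ [_ [_ Qy]]] := restriction_phi semiflow_Phi xy.
    apply/eqP; rewrite eq_le (proj1 xy) andbT leNgt; apply/negP => t0.
    by apply: nPQx; split => //; exact: sQ Qy (sub0 _ _ _ xy) t0.
  right => t y /restriction_reverse yx.
  have [[_ [Py _]] _ _] := restriction_phi semiflow_Phi yx.
  apply/eqP; rewrite eq_le (proj1 yx) andbT leNgt; apply/negP => t0.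
  by apply: nPx; exact: sP Py (sub0 _ _ _ yx) t0.
- have iP1 : plus_invariant (restriction Phi C) P1.
    move=> x t y [Px Cx] xy; split; first exact: iP xy.
    by have [] := restriction_phi semiflow_Phi xy.
  split => //.
  + exact: closedI.
  + by apply: closedI; [exact: closedI|exact/open_closedC/open_interior].
  + by split => [x []|x []].
  + move=> x t y [P1x nQx] xy; split; first exact: iP1 xy.
    (* In reverse time [Q] is moved into its interior: were [y] inside [Q], the
       point [x] would have been inside [Q] as well. *)
    move=> Qy; apply: nQx; have [t0 _] := xy.
    move: t0; rewrite le_eqVlt => /predU1P[t0|t0]; last first.
      by apply: sQ xy t0; exact: interior_subset.
    have [_ + _] := restriction_phi semiflow_Phi xy.
    by rewrite -t0 => /(semiflow_refl_eq semiflow_Phi) ->.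
  + rewrite AE => x Ax; split; last by move=> [_]; apply; exact: AQ.
    by rewrite /P1 interiorI; split; [exact: AP|exact/VCo/AV].
  + exact: subset_trans P12 (subset_trans C0V VCo).
- by move=> x [/PU].
- by split.
- exact: subset_trans clC0 (subset_trans C0V VCo).
Qed.
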